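(* There is a universal constant $C>0$ such that for every $p\in[1,\infty]$, every $n\in\mathbb N$ and every $k\in\{1,\dots,n\}$ we have $\mathsf e\big((\ell_p^n)_{\le k}\big)\le C\,k^{\max\{\frac1p,\frac12\}}$.
   Context: All vector spaces are over the real scalars, $1/\infty=0$. $(\ell_p^n)_{\le k}$ denotes the set of vectors in $\mathbb R^n$ with at most $k$ nonzero coordinates, equipped with the metric inherited from $\ell_p^n$. For a metric space $(\mathcal M,d_{\mathcal M})$, the Lipschitz extension modulus $\mathsf e(\mathcal M)\in[1,\infty]$ is the infimum over those $L\in[1,\infty]$ such that for every nonempty subset $\mathscr C\subseteq\mathcal M$, every Banach space $\mathbf Z$ and every Lipschitz function $f:\mathscr C\to\mathbf Z$ there is $F:\mathcal M\to\mathbf Z$ with $F|_{\mathscr C}=f$ whose Lipschitz constant on $\mathcal M$ is at most $L$ times the Lipschitz constant of $f$ on $\mathscr C$. *)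

(* Defs.v *)
From HB Require Import structures.
From mathcomp Require Import all_boot all_order all_algebra.
From mathcomp Require Import all_classical all_reals all_analysis.

Set Implicit Arguments.
Unset Strict Implicit.
Unset Printing Implicit Defensive.

Import Order.TTheory GRing.Theory Num.Theory.
Import numFieldNormedType.Exports.

Local Open Scope classical_set_scope.
Local Open Scope ring_scope.

(** The Lipschitz constant of the restriction of [f] to [A]: the infimum of the
    admissible constants, which is [+oo] iff the restriction is not Lipschitz. *)
Definition lip_const (R : realType) (M : metricType R) (Z : normedModType R)
    (A : set M) (f : M -> Z) : \bar R :=
  ereal_inf [set K%:E | K in
    [set K : R | 0 <= K /\
      forall x y, A x -> A y -> `|f x - f y| <= K * mdist x y]].

(** A function on [A] is represented by a function on [M] of which only the
    values on [A] are used.  For [L = +oo] the bound is read with the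
    convention [+oo * 0 = 0] of [\bar R]; this does not affect the infimum
    defining [lip_ext_modulus]. *)
Definition lip_extendable (R : realType) (M : metricType R) (L : \bar R) :
    Prop :=
  forall (A : set M) (Z : completeNormedModType R) (f : M -> Z),
    A !=set0 -> (lip_const A f < +oo)%E ->
    exists F : M -> Z, (forall x, A x -> F x = f x) /\
      (lip_const [set: M] F <= L * lip_const A f)%E.

Definition lip_ext_modulus (R : realType) (M : metricType R) : \bar R :=
  ereal_inf [set L : \bar R | (1 <= L)%E /\ lip_extendable M L].

(** The value at [-oo] is irrelevant: only [1 <= p] is used. *)
Definition lp_norm (R : realType) (p : \bar R) (n : nat) (x : 'rV[R]_n) : R :=
  match p with
  | r%:E => (\sum_(i < n) `|x 0 i| `^ r) `^ r^-1
  | +oo%E => \big[Num.max/0]_(i < n) `|x 0 i|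
  | -oo%E => 0
  end.

(** The proof [p1] is a parameter of the type so that the metric structure,
    whose triangle inequality requires [1 <= p], can be attached to it. *)
Record sparse_lp (R : realType) (p : \bar R) (p1 : (1 <= p)%E) (n k : nat) :=
  SparseLp {
    sparse_val :> 'rV[R]_n ;
    _ : (#|[pred i : 'I_n | sparse_val 0%R i != 0%R]| <= k)%N }.

HB.instance Definition _ (R : realType) (p : \bar R) (p1 : (1 <= p)%E)
  (n k : nat) := [isSub for @sparse_val R p p1 n k].
HB.instance Definition _ (R : realType) (p : \bar R) (p1 : (1 <= p)%E)
  (n k : nat) := [Choice of sparse_lp p1 n k by <:].

Definition sparse_dist (R : realType) (p : \bar R) (p1 : (1 <= p)%E) (n k : nat)
  (x y : sparse_lp p1 n k) : R := lp_norm p (sparse_val x - sparse_val y).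

Lemma lp_norm0 (R : realType) (p : \bar R) (n : nat) :
  (1 <= p)%E -> lp_norm p (0 : 'rV[R]_n) = 0.
Proof.
case: p => [r| |] //= r1.
- have r0 : r != 0 by rewrite gt_eqF// (lt_le_trans ltr01).
  rewrite big1 ?powR0 ?invr_eq0// => i _.
  by rewrite mxE normr0 powR0.
- by elim/big_ind: _ => // [a b -> ->|i _]; rewrite ?maxxx ?mxE ?normr0.
Qed.

Lemma lp_norm_eq0 (R : realType) (p : \bar R) (n : nat) (x : 'rV[R]_n) :
  (1 <= p)%E -> lp_norm p x = 0 -> x = 0.
Proof.
case: p => [r| |] //= r1.
- move/eqP; rewrite powR_eq0 => /andP[/eqP s0 _].
  apply/rowP => i; rewrite mxE; apply/eqP.
  have /eqP := psumr_eq0P (fun j _ => powR_ge0 `|x 0 j| r) s0 (i := i) isT.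
  by rewrite powR_eq0 normr_eq0 => /andP[].
- move=> m0; apply/rowP => i; rewrite mxE; apply/eqP.
  by rewrite -normr_le0 -m0 le_bigmax.
Qed.

Lemma lp_normN (R : realType) (p : \bar R) (n : nat) (x : 'rV[R]_n) :
  lp_norm p (- x) = lp_norm p x.
Proof.
have nN i : `|(- x) 0 i| = `|x 0 i| by rewrite mxE normrN.
case: p => [r| |]; rewrite /lp_norm.
- by under eq_bigr do rewrite nN.
- by apply: eq_bigr => i _; rewrite nN.
- by [].
Qed.

Lemma lp_norm_Lnorm (R : realType) (r : R) (n : nat) (x : 'rV[R]_n) : 1 <= r ->
  (lp_norm r%:E x)%:E = Lnorm (@counting nat R) r%:E
    (EFin \o (fun j : nat => oapp (x 0) 0 (insub j : option 'I_n))).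
Proof.
move=> r1; have r0 : 0 < r by rewrite (lt_le_trans ltr01).
rewrite Lnorm_counting//.
rewrite (nneseries_split 0 n); last by move=> k _; rewrite lee_fin powR_ge0.
rewrite add0n ereal_series_cond eseries0 ?adde0; last first.
  move=> j _ /= /andP[nj _]; rewrite insubF; last by rewrite ltnNge nj.
  by rewrite /= normr0 powR0// gt_eqF.
rewrite big_mkord /= -poweR_EFin -sumEFin; congr poweR.
by apply: eq_bigr => i _; rewrite /= (valK i).
Qed.

Lemma ler_lp_normD (R : realType) (p : \bar R) (n : nat) (x y : 'rV[R]_n) :
  (1 <= p)%E -> lp_norm p (x + y) <= lp_norm p x + lp_norm p y.
Proof.
case: p => [r| |]// r1.
- have {}r1 : 1 <= r := r1.
  have H (a b c : R) (A B D : \bar R) : c%:E = D -> a%:E = A -> b%:E = B ->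
      (D <= A + B)%E -> c <= a + b.
    by move=> <- <- <-; rewrite -EFinD lee_fin.
  apply: (H _ _ _ _ _ _ _ (lp_norm_Lnorm x r1) (lp_norm_Lnorm y r1)
    (minkowski_EFin _ _ _ r1)) => //.
  apply: (etrans (lp_norm_Lnorm (x + y) r1)); apply: eq_Lnorm => j /=.
  by case: insubP => [i _ _|_] /=; rewrite ?mxE ?addr0.
- rewrite /=; apply: bigmax_le => [|i _].
    by rewrite addr_ge0//; apply: bigmax_ge_id.
  by rewrite mxE (le_trans (ler_normD _ _))// lerD// le_bigmax.
Qed.

Lemma sparse_distxx (R : realType) (p : \bar R) (p1 : (1 <= p)%E) (n k : nat)
  (x : sparse_lp p1 n k) : sparse_dist x x = 0.
Proof. by rewrite /sparse_dist subrr lp_norm0. Qed.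

Lemma sparse_dist_positivity (R : realType) (p : \bar R) (p1 : (1 <= p)%E)
  (n k : nat) (x y : sparse_lp p1 n k) : sparse_dist x y = 0 -> x = y.
Proof.
by move/(lp_norm_eq0 p1)/eqP; rewrite subr_eq0 => /eqP xy; apply: val_inj.
Qed.

Lemma sparse_dist_sym (R : realType) (p : \bar R) (p1 : (1 <= p)%E)
  (n k : nat) (x y : sparse_lp p1 n k) : sparse_dist x y = sparse_dist y x.
Proof. by rewrite /sparse_dist -opprB lp_normN. Qed.

Lemma sparse_dist_triangle (R : realType) (p : \bar R) (p1 : (1 <= p)%E)
  (n k : nat) (y x z : sparse_lp p1 n k) :
  sparse_dist x z <= sparse_dist x y + sparse_dist y z.
Proof.
rewrite /sparse_dist -(subrKA (sparse_val y)).
exact: ler_lp_normD.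
Qed.

HB.instance Definition _ (R : realType) (p : \bar R) (p1 : (1 <= p)%E)
  (n k : nat) := @isMetric.Build R (sparse_lp p1 n k)
    (@sparse_dist R p p1 n k) (@sparse_distxx R p p1 n k)
    (@sparse_dist_positivity R p p1 n k) (@sparse_dist_sym R p p1 n k)
    (@sparse_dist_triangle R p p1 n k).

Lemma mdist_sparse_lpE (R : realType) (p : \bar R) (p1 : (1 <= p)%E)
  (n k : nat) (x y : sparse_lp p1 n k) :
  mdist x y = lp_norm p (sparse_val x - sparse_val y).
Proof. by []. Qed.

(* Main.v *)
Require Import Defs.
From mathcomp Require Import all_boot all_order all_algebra.
From mathcomp Require Import all_classical all_reals all_analysis.
From mathcomp Require Import ring lra zify.
Import Order.TTheory GRing.Theory Num.Theory.
Import numFieldNormedType.Exports.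
Local Open Scope classical_set_scope.
Local Open Scope ring_scope.
Set Implicit Arguments.
Unset Strict Implicit.
Unset Printing Implicit Defensive.

(** Let M be the set of k-sparse vectors with the l_p metric, A a nonempty
    subset of M, and f : A -> Z a Lipschitz map into a Banach space.  The
    extension of f is built from averages of f, one for each scale s, which are
    then glued along the distance to A.

    At scale s, a point x is rounded at random to a point of a grid of mesh
    a = s / k^(1/p), coordinate by coordinate and independently: the i-th
    coordinate of x / a goes to one of its two neighbouring integers j, with
    probability cosbump (x_i / a - j)^2.  As cosbump is 1 at 0 and vanishes
    outside ]-1, 1[, a zero coordinate stays zero.  Hence only the support of x
    is perturbed, by at most a in each coordinate, and the rounded point is
    within a * k^(1/p) = s of x, whatever the dimension n.  Sending each grid
    point to a nearby point of A and averaging f gives a map G at scale s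
    (sparse_scale_extension).

    The Lipschitz constant of G is governed by the total variation distance
    between the roundings of x and y.  The square roots of the rounding
    probabilities form a product unit vector; each factor depends on its
    coordinate in a Lipschitz way, and the squared Hilbert distance of product
    unit vectors is at most the sum of those of the factors (prod_dist_le).  So
    the total variation is at most a constant times |x - y|_2 / a, and
    sparse_l2_le_lp turns this into k^max(1/p, 1/2) |x - y|_p / s, because x - y
    has at most 2k nonzero coordinates.

    To glue the scales (lipschitz_extension_of_scales), interpolate linearly
    between the maps of scales 2^m.  As long as s exceeds the distance D x of x
    to A, the value H x s so obtained is Lipschitz in x and in s.  The extension
    is F x = lim H x s as s decreases to D x, which is f x when x is in A. *)

(** * Hellinger distance of product vectors *)

Lemma onem_prod_le (R : realType) (I : finType) (c : I -> R) :
  (forall i, 0 <= c i <= 1) -> 1 - \prod_i c i <= \sum_i (1 - c i).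
Proof.
move=> c01.
suff [//] : 1 - \prod_i c i <= \sum_i (1 - c i) /\ 0 <= \prod_i c i <= 1.
elim/big_rec2 : _ => [|i y z _ [yz /andP[z0 z1]]]; first by split; lra.
by have /andP[c0 c1] := c01 i; split; nra.
Qed.

(** Subadditivity of the squared Hellinger distance: P = prod_i p_i and
    Q = prod_i q_i are unit vectors with scalar product prod_i <p_i, q_i>, so
    |P - Q|^2 = 2 (1 - prod_i <p_i, q_i>) <= sum_i |p_i - q_i|^2.  The l_1
    distance of P^2 and Q^2 then follows from P^2 - Q^2 = (P - Q) (P + Q) and
    |P + Q| <= 2. *)
Lemma prod_dist_le (R : realType) (I T : finType) (p q : I -> T -> R) (h : R) :
  (forall i j, 0 <= p i j) -> (forall i j, 0 <= q i j) ->
  (forall i, \sum_j p i j ^+ 2 = 1) -> (forall i, \sum_j q i j ^+ 2 = 1) ->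
  0 < h -> \sum_i \sum_j (p i j - q i j) ^+ 2 <= h ^+ 2 ->
  \sum_(J : {ffun I -> T})
    `|\prod_i p i (J i) ^+ 2 - \prod_i q i (J i) ^+ 2| <= 2 * h.
Proof.
move=> p0 q0 p1 q1 h0 pqh.
pose P (J : {ffun I -> T}) := \prod_i p i (J i).
pose Q (J : {ffun I -> T}) := \prod_i q i (J i).
pose c i := \sum_j p i j * q i j.
have P1 : \sum_J P J ^+ 2 = 1.
  under eq_bigr do rewrite -prodrXl.
  by rewrite -(bigA_distr_bigA (fun i j => p i j ^+ 2)) big1.
have Q1 : \sum_J Q J ^+ 2 = 1.
  under eq_bigr do rewrite -prodrXl.
  by rewrite -(bigA_distr_bigA (fun i j => q i j ^+ 2)) big1.
have PQ : \sum_J P J * Q J = \prod_i c i.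
  by rewrite bigA_distr_bigA; apply: eq_bigr => J _; rewrite -big_split.
have cE i : \sum_j (p i j - q i j) ^+ 2 = 2 * (1 - c i).
  under eq_bigr do rewrite sqrrB.
  by rewrite big_split/= sumrB p1 q1 sumrMnl /c; lra.
have c01 i : 0 <= c i <= 1.
  rewrite sumr_ge0/=; last by move=> j _; rewrite mulr_ge0.
  have : 0 <= \sum_j (p i j - q i j) ^+ 2.
    by apply: sumr_ge0 => j _; exact: sqr_ge0.
  by rewrite cE; lra.
have PQh : \sum_J (P J - Q J) ^+ 2 <= h ^+ 2.
  under eq_bigr do rewrite sqrrB.
  rewrite big_split/= sumrB P1 Q1 sumrMnl PQ.
  have := onem_prod_le c01.
  have : \sum_i \sum_j (p i j - q i j) ^+ 2 = 2 * \sum_i (1 - c i).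
    by rewrite mulr_sumr; apply: eq_bigr => i _; rewrite cE.
  by move: pqh; lra.
have PQ4 : \sum_J (P J + Q J) ^+ 2 <= 4.
  have : 0 <= \sum_J (P J - Q J) ^+ 2.
    by apply: sumr_ge0 => J _; exact: sqr_ge0.
  under eq_bigr do rewrite sqrrB.
  under [X in _ -> X <= _]eq_bigr do rewrite sqrrD.
  rewrite !big_split/= sumrN sumrMnl P1 Q1.
  lra.
have h1 : 0 < h^-1 by rewrite invr_gt0.
(* Cauchy-Schwarz, in the form |x y| <= x^2 / h + h y^2 / 4 *)
apply: (@le_trans _ _ (\sum_J (h^-1 * (P J - Q J) ^+ 2
    + h / 4 * (P J + Q J) ^+ 2))); last first.
  rewrite big_split/= -!mulr_sumr.
  have : h^-1 * \sum_J (P J - Q J) ^+ 2 <= h^-1 * h ^+ 2.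
    by rewrite ler_pM2l.
  rewrite expr2 mulrA mulVf ?mul1r ?gt_eqF// => H1.
  have := ler_wpM2l (_ : 0 <= h / 4) PQ4.
  by move=> /(_ ltac:(lra)); lra.
apply: ler_sum => J _.
rewrite !prodrXl -/(P J) -/(Q J) subr_sqr normrM.
have P0 : 0 <= P J by apply: prodr_ge0.
have Q0 : 0 <= Q J by apply: prodr_ge0.
rewrite [`|P J + Q J|]ger0_norm; last by rewrite addr_ge0.
rewrite -(real_normK (num_real (P J - Q J))).
set a := `|_|; set b := P J + Q J.
have -> : h^-1 * a ^+ 2 + h / 4 * b ^+ 2 = h^-1 * (a - h / 2 * b) ^+ 2 + a * b.
  by field; rewrite gt_eqF.
by rewrite lerDr mulr_ge0 ?sqr_ge0// ltW.
Qed.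

(** * A Lipschitz square root of a partition of unity *)

Lemma cos_lipschitz (R : realType) (x y : R) : `|cos x - cos y| <= `|x - y|.
Proof.
wlog xy : x y / x <= y.
  by move=> H; case: (leP x y) => [|/ltW] /H//; rewrite distrC [leRHS]distrC.
have [c _ E] := MVT_segment xy (fun z _ => is_derive_cos z)
  (continuous_subspaceT (@continuous_cos R)).
rewrite distrC E distrC normrM -[leRHS]mul1r ler_wpM2r//.
by rewrite normrN ler_norml sin_le1 sin_geN1.
Qed.

(** The squares of the integer translates of this bump form a partition of
    unity, since cos^2 + sin^2 = 1.  A cosine is used so that the bump itself,
    and not only its square, is Lipschitz: this is what the Hilbert distance of
    prod_dist_le needs. *)
Definition cosbump (R : realType) (u : R) : R := cos (pi / 2 * Num.min `|u| 1).

Lemma cosbump_ge0 (R : realType) (u : R) : 0 <= cosbump u.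
Proof.
have p0 := @pi_gt0 R; apply: cos_ge0_pihalf.
set m := Num.min _ _.
have m0 : 0 <= m by rewrite le_min normr_ge0 ler01.
have m1 : m <= 1 by rewrite ge_min lexx orbT.
by apply/andP; split; nra.
Qed.

Lemma cosbump0 (R : realType) : cosbump (0 : R) = 1.
Proof. by rewrite /cosbump normr0 min_l// mulr0 cos0. Qed.

Lemma cosbump_eq0 (R : realType) (u : R) : 1 <= `|u| -> cosbump u = 0.
Proof. by move=> u1; rewrite /cosbump min_r// mulr1 cos_pihalf. Qed.

Lemma cosbump_sqrD (R : realType) (u : R) :
  0 <= u <= 1 -> cosbump u ^+ 2 + cosbump (u - 1) ^+ 2 = 1.
Proof.
move=> /andP[u0 u1].
have -> : cosbump (u - 1) = cos (pi / 2 * (1 - u)).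
  by rewrite /cosbump distrC ger0_norm ?min_l//; lra.
rewrite /cosbump ger0_norm// min_l// mulrBr mulr1.
by rewrite -[cos (pi / 2 - _)]cosN opprB cosBpihalf cos2Dsin2.
Qed.

Lemma ler_dist_min1 (R : realType) (a b : R) :
  `|Num.min a 1 - Num.min b 1| <= `|a - b|.
Proof.
have := ler_norm (a - b); have := ler_norm (b - a); rewrite distrC ler_norml.
by case: (leP a 1) => ?; case: (leP b 1) => ?; lra.
Qed.

Lemma cosbump_lipschitz (R : realType) (u v : R) :
  `|cosbump u - cosbump v| <= 2 * `|u - v|.
Proof.
apply: le_trans (cos_lipschitz _ _) _; rewrite -mulrBr normrM.
have pi0 : 0 <= pi / 2 :> R by rewrite divr_ge0 ?pi_ge0.
apply: ler_pM => //; first by rewrite ger0_norm// ltW// pihalf_lt2.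
apply: le_trans (ler_dist_dist u v).
exact: ler_dist_min1.
Qed.

Lemma cosbump_floor_eq0 (R : realType) (s : R) (j : int) :
  j \notin [:: Num.floor s; Num.floor s + 1] -> cosbump (s - j%:~R) = 0.
Proof.
rewrite !inE negb_or => /andP[jm jm1].
have /andP[ms sm] := floor_itv s.
apply: cosbump_eq0.
have [jlt|jge] := ltP j (Num.floor s).
  have : (j + 1)%:~R <= (Num.floor s)%:~R :> R by rewrite ler_int; lia.
  rewrite intrD1 => ?; rewrite ger0_norm; lra.
have : (Num.floor s + 1)%:~R + 1 <= j%:~R :> R by rewrite -intrD1 ler_int; lia.
by move=> ?; rewrite ler0_norm; lra.
Qed.

Lemma sum_cosbump_sqr (R : realType) (s : R) (r : seq int) : uniq r ->
  Num.floor s \in r -> Num.floor s + 1 \in r ->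
  \sum_(j <- r) cosbump (s - j%:~R) ^+ 2 = 1.
Proof.
move=> ur mr m1r; have /andP[ms sm] := floor_itv s.
rewrite (bigD1_seq (Num.floor s))//= -big_filter.
have m1f : Num.floor s + 1 \in [seq j <- r | j != Num.floor s].
  by rewrite mem_filter m1r andbT; lia.
rewrite (bigD1_seq _ m1f) ?filter_uniq//= big_filter_cond.
rewrite big1 => [|j /andP[jm jm1]].
  rewrite addr0 intrD1 opprD addrA cosbump_sqrD//.
  by move: sm; rewrite intrD1; lra.
by rewrite cosbump_floor_eq0 ?expr0n// !inE negb_or jm jm1.
Qed.

(** At most two translates of the bump are nonzero at s and two at t, and each
    of them varies by at most 2 |s - t|. *)
Lemma sum_cosbump_dist (R : realType) (s t : R) (r : seq int) : uniq r ->
  \sum_(j <- r) (cosbump (s - j%:~R) - cosbump (t - j%:~R)) ^+ 2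
    <= 16 * (s - t) ^+ 2.
Proof.
move=> ur; set D := (s - t) ^+ 2.
have D0 : 0 <= D := sqr_ge0 _.
pose act (u : R) (j : int) : bool := j \in [:: Num.floor u; Num.floor u + 1].
have act2 u : \sum_(j <- r) (act u j)%:R * (4 * D) <= 8 * D.
  have cE : \sum_(j <- r) (act u j)%:R = (count (act u) r)%:R :> R.
    rewrite -sum1_count natr_sum [RHS]big_mkcond.
    by apply: eq_bigr => j _; case: (act u j).
  rewrite -mulr_suml cE.
  suff c2 : (count (act u) r <= 2)%N.
    have : (count (act u) r)%:R <= 2%:R :> R by rewrite ler_nat.
    by nra.
  rewrite -size_filter.
  have : {subset seq.filter (act u) r <= [:: Num.floor u; Num.floor u + 1]}.
    by move=> j; rewrite mem_filter => /andP[].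
  by move/uniq_leq_size; apply; rewrite filter_uniq.
apply: (@le_trans _ _ (\sum_(j <- r) ((act s j)%:R * (4 * D)
    + (act t j)%:R * (4 * D)))); last first.
  by rewrite big_split/=; have := act2 s; have := act2 t; lra.
apply: ler_sum => j _.
have [sj|sj] := boolP (act s j); have [tj|tj] := boolP (act t j); last first.
  by rewrite (cosbump_floor_eq0 sj) (cosbump_floor_eq0 tj) subrr expr0n/=; lra.
all: rewrite ?mul1r ?mul0r ?addr0 ?add0r.
all: have b : (cosbump (s - j%:~R) - cosbump (t - j%:~R)) ^+ 2 <= 4 * D.
all: try (have := cosbump_lipschitz (s - j%:~R) (t - j%:~R);
  rewrite opprB addrA subrK => H;
  rewrite -[leLHS]real_normK ?num_real// /D -(real_normK (num_real (s - t)));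
  have := normr_ge0 (cosbump (s - j%:~R) - cosbump (t - j%:~R));
  have := normr_ge0 (s - t); nra).
all: by rewrite ?b//; lra.
Qed.

(** * Randomized rounding to integer points *)

(** The probability that independent randomized rounding of the coordinates
    sends y to the integer point J. *)
Definition grid_weight (R : realType) n (y : 'I_n -> R)
    (J : {ffun 'I_n -> int}) : R := \prod_i cosbump (y i - (J i)%:~R) ^+ 2.

Lemma grid_weight_ge0 (R : realType) n (y : 'I_n -> R) J : 0 <= grid_weight y J.
Proof. by apply: prodr_ge0 => i _; exact: sqr_ge0. Qed.

Lemma grid_weight_near (R : realType) n (y : 'I_n -> R) J i :
  grid_weight y J != 0 -> `|y i - (J i)%:~R| <= 1.
Proof.
apply: contra_neqT; rewrite -ltNge => /ltW /cosbump_eq0 yJ.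
by rewrite /grid_weight (bigD1 i)//= yJ expr0n mul0r.
Qed.

(** Rounding does not enlarge the support; this is why the estimates depend on
    the sparsity and not on the dimension. *)
Lemma grid_weight_support (R : realType) n (y : 'I_n -> R) J i :
  grid_weight y J != 0 -> y i = 0 -> J i = 0.
Proof.
move=> wJ y0; move: wJ; apply: contra_neq_eq => J0.
rewrite /grid_weight (bigD1 i)//= cosbump_eq0 ?expr0n ?mul0r//.
by rewrite y0 sub0r normrN -intr_norm ler1z; lia.
Qed.

(** Two points y and z give mass to finitely many integer points only; on a
    common finite list rr carrying both, the rounding laws are finite products,
    to which prod_dist_le applies. *)
Lemma grid_weight_cover (R : realType) n (y z : 'I_n -> R) :
  exists rr : seq {ffun 'I_n -> int}, uniq rr /\
    (forall J, J \notin rr -> grid_weight y J = 0 /\ grid_weight z J = 0) /\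
    \sum_(J <- rr) grid_weight y J = 1 /\
    \sum_(J <- rr) grid_weight z J = 1 /\
    forall h, 0 < h -> 16 * \sum_i (y i - z i) ^+ 2 <= h ^+ 2 ->
      \sum_(J <- rr) `|grid_weight y J - grid_weight z J| <= 2 * h.
Proof.
pose fl (u : 'I_n -> R) :=
  [seq Num.floor (u i) | i : 'I_n] ++ [seq Num.floor (u i) + 1 | i : 'I_n].
pose r := undup (fl y ++ fl z).
have ur : uniq r by rewrite undup_uniq.
have flyr i : Num.floor (y i) \in r /\ Num.floor (y i) + 1 \in r.
  by split; rewrite mem_undup !mem_cat; apply/orP; left; apply/orP;
    [left|right]; apply/mapP; exists i; rewrite ?mem_enum.
have flzr i : Num.floor (z i) \in r /\ Num.floor (z i) + 1 \in r.
  by split; rewrite mem_undup !mem_cat; apply/orP; right; apply/orP;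
    [left|right]; apply/mapP; exists i; rewrite ?mem_enum.
pose e (J : {ffun 'I_n -> 'I_(size r)}) : {ffun 'I_n -> int} :=
  [ffun i => nth 0 r (J i)].
have sumr (g : int -> R) : \sum_(j < size r) g (nth 0 r j) = \sum_(j <- r) g j.
  by rewrite (big_nth 0) big_mkord.
have y1 i : \sum_(j < size r) cosbump (y i - (nth 0 r j)%:~R) ^+ 2 = 1.
  rewrite (sumr (fun j => cosbump (y i - j%:~R) ^+ 2)).
  by have [] := flyr i; exact: sum_cosbump_sqr.
have z1 i : \sum_(j < size r) cosbump (z i - (nth 0 r j)%:~R) ^+ 2 = 1.
  rewrite (sumr (fun j => cosbump (z i - j%:~R) ^+ 2)).
  by have [] := flzr i; exact: sum_cosbump_sqr.
have wE (u : 'I_n -> R) J :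
    grid_weight u (e J) = \prod_i cosbump (u i - (nth 0 r (J i))%:~R) ^+ 2.
  by apply: eq_bigr => i _; rewrite ffunE.
have w0 (u : 'I_n -> R) :
    (forall i, Num.floor (u i) \in r /\ Num.floor (u i) + 1 \in r) ->
    forall J, J \notin map e (index_enum {ffun 'I_n -> 'I_(size r)}) ->
    grid_weight u J = 0.
  move=> ur' J; apply: contraNeq => uJ.
  have Jr i : (index (J i) r < size r)%N.
    rewrite index_mem; have [u1 u2] := ur' i.
    have [|/cosbump_floor_eq0 b0] :=
        boolP (J i \in [:: Num.floor (u i); Num.floor (u i) + 1]).
      by rewrite !inE => /orP[] /eqP ->.
    by move: uJ; rewrite /grid_weight (bigD1 i)//= b0 expr0n mul0r eqxx.
  apply/mapP; exists [ffun i => Ordinal (Jr i)]; rewrite ?mem_index_enum//.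
  by apply/ffunP => i; rewrite !ffunE/= nth_index// -index_mem.
exists (map e (index_enum {ffun 'I_n -> 'I_(size r)})); split.
  rewrite map_inj_uniq ?index_enum_uniq// => J J' /ffunP eJ.
  apply/ffunP => i; have := eJ i; rewrite !ffunE => /eqP.
  by rewrite nth_uniq// => /eqP /val_inj.
split; first by move=> J Jr; split; apply: w0 => // i.
rewrite !big_map.
split.
  under eq_bigr do rewrite wE.
  rewrite -(bigA_distr_bigA (fun i (j : 'I_(size r)) =>
    cosbump (y i - (nth 0 r j)%:~R) ^+ 2)).
  by rewrite big1.
split.
  under eq_bigr do rewrite wE.
  rewrite -(bigA_distr_bigA (fun i (j : 'I_(size r)) =>
    cosbump (z i - (nth 0 r j)%:~R) ^+ 2)).
  by rewrite big1.
move=> h h0 yzh; under eq_bigr do rewrite !wE.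
apply: (prod_dist_le
  (p := fun i (j : 'I_(size r)) => cosbump (y i - (nth 0 r j)%:~R))
  (q := fun i (j : 'I_(size r)) => cosbump (z i - (nth 0 r j)%:~R))) => //.
- by move=> *; exact: cosbump_ge0.
- by move=> *; exact: cosbump_ge0.
apply: le_trans yzh; rewrite mulr_sumr; apply: ler_sum => i _.
rewrite (sumr (fun j => (cosbump (y i - j%:~R) - cosbump (z i - j%:~R)) ^+ 2)).
exact: sum_cosbump_dist.
Qed.

(** * Gluing approximate extensions over all scales *)

(** A map that is Lipschitz on the right of D has a limit at D, by completeness.
    The limit is described by its distance to the values, the only form in
    which it is used. *)
Lemma lipschitz_right_limit (R : realType) (Z : completeNormedModType R)
    (h : R -> Z) (D B : R) : 0 <= B ->
  (forall s t, D < s -> s <= t -> `|h s - h t| <= B * (t - s)) ->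
  exists z, forall s, D < s -> `|z - h s| <= B * (s - D).
Proof.
move=> B0 hB.
have /cauchy_cvgP hcvg : cauchy (h @ D^'+).
  apply: cauchy_exP => e e0; set u := D + e / (B + 1).
  have eB0 : 0 < e / (B + 1) by rewrite divr_gt0// ltr_wpDl.
  exists (h u).
  change (\forall t \near D^'+, ball (h u) e (h t)); near=> t.
  rewrite -ball_normE /ball_ /= distrC; apply: (le_lt_trans (hB t u _ _)) => //.
    by near: t; apply: nbhs_right_le; rewrite /u; lra.
  have tD : D < t by [].
  rewrite (@le_lt_trans _ _ (B * (e / (B + 1))))//.
    by rewrite ler_wpM2l// /u; lra.
  by rewrite mulrCA gtr_pMr// ltr_pdivrMr ?mul1r; lra.
exists (lim (h @ D^'+)) => s Ds.
have /cvg_norm : (h t - h s) @[t --> D^'+] --> lim (h @ D^'+) - h s.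
  by apply: cvgB => //; exact: cvg_cst.
move=> /cvgr_to_le; apply; near=> t.
have tD : D < t by [].
have ts : t <= s by near: t; exact: nbhs_right_le.
by rewrite (le_trans (hB _ _ _ _))// ler_wpM2l//; lra.
Unshelve. all: by end_near. Qed.

Lemma dyadic_scale (R : realType) (s : R) : 0 < s ->
  exists m : int, 2 ^ m <= s < 2 ^ (m + 1).
Proof.
move=> s0; have l2 : 0 < ln 2 :> R by rewrite ln_gt0// ltr1n.
have pow2 (m : int) : (2 : R) ^ m = expR (m%:~R * ln 2).
  by rewrite -powR_intmul// /powR gt_eqF.
exists (Num.floor (ln s / ln 2)).
have /andP[ms sm] := floor_itv (ln s / ln 2).
rewrite !pow2 -[X in _ <= X < _](@lnK _ s)// ler_expR ltr_expR.
by rewrite -ler_pdivlMr// -ltr_pdivrMr// ms sm.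
Qed.

(** It is enough to have, at each scale s, a map that is K-Lipschitz on the
    points within 2s of A and is off from f by O(s) near A.  Let H x s
    interpolate linearly, in s, between the dyadic scales.  For D y <= D x and s
    slightly larger than D x, both x and y are close enough to A for the scale
    s, whence |H x s - H y s| <= K |x - y|; and H y is Lipschitz in the scale
    beyond D y, so that lowering s to about D y changes H y by O(D x - D y),
    which is O(|x - y|).  Since only scales s > D x are used, with limits from
    the right, A need not be closed. *)
Lemma lipschitz_extension_of_scales (R : realType) (M : metricType R)
    (Z : completeNormedModType R) (A : set M) (f : M -> Z) (K a : R) :
  A !=set0 -> 0 <= a ->
  (forall s, 0 < s -> exists G : M -> Z,
    (forall x c, A c -> mdist x c <= 2 * s -> `|G x - f c| <= a * s) /\
    (forall x y b c, A b -> A c -> mdist x b <= 2 * s -> mdist y c <= 2 * s ->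
      `|G x - G y| <= K * mdist x y)) ->
  exists F : M -> Z, (forall x, A x -> F x = f x) /\
    forall x y, `|F x - F y| <= (K + 6 * a) * mdist x y.
Proof.
move=> [c0 Ac0] a0 scales.
have e2 (m : int) : 2 ^ (m + 1) = 2 * 2 ^ m :> R.
  by rewrite expfzDr// expr1z mulrC.
have p2 (m : int) : 0 < 2 ^ m :> R by rewrite exprz_gt0.
have /choice[G Gs] : forall m : int, exists G : M -> Z,
    (forall x c, A c -> mdist x c <= 2 * 2 ^ m -> `|G x - f c| <= a * 2 ^ m) /\
    (forall x y b c, A b -> A c ->
      mdist x b <= 2 * 2 ^ m -> mdist y c <= 2 * 2 ^ m ->
      `|G x - G y| <= K * mdist x y).
  by move=> m; exact: scales.
have G1 m := (Gs m).1.
have G2 m := (Gs m).2.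
have /choice[lg lgP] : forall s : R, exists m : int,
    0 < s -> 2 ^ m <= s < 2 ^ (m + 1).
  move=> s; have [/dyadic_scale[m ms]|_] := ltP 0 s; first by exists m.
  by exists 0.
pose u s : R := s / 2 ^ lg s - 1.
have u01 s : 0 < s -> 0 <= u s <= 1.
  move=> /lgP /andP[]; rewrite e2 => ls sl; rewrite /u.
  by rewrite subr_ge0 ler_pdivlMr// mul1r ls lerBlDr ler_pdivrMr//=; lra.
pose H x s := (1 - u s) *: G (lg s) x + u s *: G (lg s + 1) x.
pose D x := inf [set mdist x c | c in A].
have D0 x : 0 <= D x.
  apply: lb_le_inf => [|_ [c _ <-]]; last exact: mdist_ge0.
  by exists (mdist x c0), c0.
have DA x c : A c -> D x <= mdist x c.
  move=> Ac; apply: ge_inf; last by exists c.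
  by exists 0 => _ [b _ <-]; exact: mdist_ge0.
have Dlt x s : D x < s -> exists2 c, A c & mdist x c < s.
  move=> Dxs; have [||_ [c Ac <-] xc] :=
    @inf_adherent R [set mdist x c | c in A] (s - D x).
  - by rewrite subr_gt0.
  - split; first by exists (mdist x c0), c0.
    by exists 0 => _ [b _ <-]; exact: mdist_ge0.
  by exists c => //; move: xc; rewrite -/(D x); lra.
have Dlip x y : D x <= D y + mdist x y.
  rewrite leNgt; apply/negP => Dxy.
  have [|c Ac yc] := Dlt y (D x - mdist x y); first lra.
  have := DA x c Ac; have := metric_triangle x y c; lra.
have G12 x s m : D x < s -> s <= 2 * 2 ^ m ->
    `|G m x - G (m + 1) x| <= 3 * a * 2 ^ m.
  move=> /Dlt[c Ac xc] sm; have pm := p2 m.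
  have h1 : `|G m x - f c| <= a * 2 ^ m by apply: G1 => //; lra.
  have h2 : `|G (m + 1) x - f c| <= a * 2 ^ (m + 1).
    by apply: G1 => //; rewrite e2; lra.
  have := ler_distD (f c) (G m x) (G (m + 1) x).
  by move: h2; rewrite e2 [`|f c - _|]distrC; lra.
have H1 x s c : 0 < s -> A c -> mdist x c <= s ->
    `|H x s - f c| <= 2 * a * s.
  move=> s0 Ac xc; have /andP[] := lgP _ s0; rewrite e2 => ls sl.
  have pm := p2 (lg s); have /andP[v0 v1] := u01 _ s0.
  have h1 : `|G (lg s) x - f c| <= a * 2 ^ lg s by apply: G1 => //; lra.
  have h2 : `|G (lg s + 1) x - f c| <= a * 2 ^ (lg s + 1).
    by apply: G1 => //; rewrite e2; lra.
  have -> : H x s - f c = (1 - u s) *: (G (lg s) x - f c)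
      + u s *: (G (lg s + 1) x - f c).
    by rewrite !scalerBr addrACA -opprD -scalerDl subrK scale1r.
  rewrite (le_trans (ler_normD _ _))// !normrZ !ger0_norm//; last lra.
  have : a * 2 ^ lg s <= a * s by rewrite ler_wpM2l.
  move: h2; rewrite e2.
  have := normr_ge0 (G (lg s) x - f c).
  have := normr_ge0 (G (lg s + 1) x - f c).
  by nra.
have H2 x y s : D x < s -> D y < s -> `|H x s - H y s| <= K * mdist x y.
  move=> xs ys; have s0 := le_lt_trans (D0 x) xs.
  have /andP[] := lgP _ s0; rewrite e2 => ls sl.
  have pm := p2 (lg s); have /andP[v0 v1] := u01 _ s0.
  have [b Ab xb] := Dlt _ _ xs; have [c Ac yc] := Dlt _ _ ys.
  have h1 : `|G (lg s) x - G (lg s) y| <= K * mdist x y.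
    by apply: (G2 _ _ _ b c) => //; lra.
  have h2 : `|G (lg s + 1) x - G (lg s + 1) y| <= K * mdist x y.
    by apply: (G2 _ _ _ b c) => //; rewrite e2; lra.
  have -> : H x s - H y s = (1 - u s) *: (G (lg s) x - G (lg s) y)
      + u s *: (G (lg s + 1) x - G (lg s + 1) y).
    by rewrite !scalerBr addrACA -opprD.
  rewrite (le_trans (ler_normD _ _))// !normrZ !ger0_norm//; last lra.
  by nra.
have H3 x s t : D x < s -> s <= t -> `|H x s - H x t| <= 6 * a * (t - s).
  move=> xs st; have s0 := le_lt_trans (D0 x) xs.
  have t0 := lt_le_trans s0 st; have xt := lt_le_trans xs st.
  have := lgP _ s0; have := lgP _ t0; rewrite !e2 => /andP[lt tl] /andP[ls sl].
  have [b Ab xb] := Dlt _ _ xs.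
  (* When t >= 2s, comparing both values with f b is enough; otherwise s and t
     lie in the same dyadic interval or in two consecutive ones. *)
  have [far|close] := leP (2 * s) t.
    have hs : `|H x s - f b| <= 2 * a * s by apply: H1 => //; lra.
    have ht : `|H x t - f b| <= 2 * a * t by apply: H1 => //; lra.
    have := ler_distD (f b) (H x s) (H x t); rewrite [`|f b - _|]distrC.
    have := ler_wpM2l a0 far.
    by lra.
  have lgst : lg s <= lg t.
    rewrite -ltzD1 -(ltr_eXz2l (x := 2 : R)) ?ltr1n// e2.
    by lra.
  have lgts : lg t <= lg s + 1.
    rewrite -ltzD1 -(ltr_eXz2l (x := 2 : R)) ?ltr1n// !e2.
    by lra.
  have HsE : H x s = G (lg s) x + u s *: (G (lg s + 1) x - G (lg s) x).
    by rewrite /H scalerBl scale1r scalerBr -addrA [- _ + _]addrC.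
  have HtE : H x t = G (lg t) x + u t *: (G (lg t + 1) x - G (lg t) x).
    by rewrite /H scalerBl scale1r scalerBr -addrA [- _ + _]addrC.
  have pm := p2 (lg s).
  have gs : `|G (lg s) x - G (lg s + 1) x| <= 3 * a * 2 ^ lg s.
    by apply: (G12 _ s) => //; lra.
  have uE w : u w * 2 ^ lg w = w - 2 ^ lg w.
    by rewrite /u mulrBl mul1r divfK// gt_eqF.
  have /andP[us0 us1] := u01 _ s0.
  have /andP[ut0 ut1] := u01 _ t0.
  have [lgE|lgE] : lg t = lg s \/ lg t = lg s + 1.
    by clear -lgst lgts; lia.
  - have uEt := uE t; rewrite lgE in uEt; have uEs := uE s.
    rewrite HsE HtE lgE opprD addrACA subrr add0r -scalerBl normrZ distrC.
    rewrite [`|G _ _ - _|]distrC ger0_norm; last by nra.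
    apply: (le_trans (ler_wpM2l _ gs)); first by nra.
    have : a * (u t * 2 ^ lg s - u s * 2 ^ lg s) = a * (t - s).
      by rewrite uEt uEs; congr (_ * _); lra.
    have : 0 <= a * (t - s) by rewrite mulr_ge0//; lra.
    by lra.
  (* in consecutive intervals, go through the value at the common endpoint *)
  have gt : `|G (lg t) x - G (lg t + 1) x| <= 3 * a * 2 ^ lg t.
    by apply: (G12 _ s) => //; rewrite lgE e2; lra.
  have -> : H x s - H x t = (1 - u s) *: (G (lg s) x - G (lg s + 1) x)
      + u t *: (G (lg t) x - G (lg t + 1) x).
    have -> : H x s = G (lg t) x + (1 - u s) *: (G (lg s) x - G (lg s + 1) x).
      rewrite lgE /H scalerBr addrCA; congr (_ + _).
      by rewrite -{2}[G (lg s + 1) x]scale1r -scalerBl subKr.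
    rewrite HtE [- (G _ _ + _)]opprD addrACA subrr add0r -scalerN.
    by rewrite [- (G _ _ - _)]opprB.
  rewrite (le_trans (ler_normD _ _))// !normrZ !ger0_norm//; last lra.
  have h1 : (1 - u s) * `|G (lg s) x - G (lg s + 1) x|
      <= 3 * (a * (2 * 2 ^ lg s - s)).
    apply: (le_trans (ler_wpM2l _ gs)); first lra.
    by have := congr1 ( *%R a) (uE s); lra.
  have h2 : u t * `|G (lg t) x - G (lg t + 1) x| <= 3 * (a * (t - 2 ^ lg t)).
    apply: (le_trans (ler_wpM2l _ gt)); first lra.
    by have := congr1 ( *%R a) (uE t); lra.
  have : 0 <= a * (t - s) by rewrite mulr_ge0//; lra.
  by move: h2; rewrite lgE e2; lra.
have /choice[F FP] : forall x, exists z, forall s, D x < s ->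
    `|z - H x s| <= 6 * a * (s - D x).
  move=> x; apply: lipschitz_right_limit; first by rewrite mulr_ge0.
  by move=> s t; exact: H3.
exists F; split=> [x Ax|].
  apply/eqP; rewrite -subr_eq0 -normr_le0; apply/ler_addgt0Pr => e e0.
  have Dx : D x = 0.
    by apply/eqP; rewrite eq_le D0 andbT -(mdistxx x); exact: DA.
  pose s := e / (8 * a + 1).
  have s0 : 0 < s by rewrite divr_gt0//; lra.
  have se : (8 * a + 1) * s = e by rewrite mulrC divfK// gt_eqF//; lra.
  have := FP x s; rewrite Dx subr0 => /(_ s0) h1.
  have h2 : `|H x s - f x| <= 2 * a * s by apply: H1 => //; rewrite mdistxx ltW.
  have := ler_distD (H x s) (F x) (f x).
  have : 0 <= a * s by rewrite mulr_ge0// ltW.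
  by lra.
move=> x y.
wlog Dyx : x y / D y <= D x.
  move=> W; have [/W//|/ltW/W] := leP (D y) (D x).
  by rewrite distrC [mdist y x]metric_sym.
apply/ler_addgt0Pr => e e0.
pose r := e / (12 * a + 1).
have r0 : 0 < r by rewrite divr_gt0//; lra.
have re : (12 * a + 1) * r = e by rewrite mulrC divfK// gt_eqF//; lra.
pose s := D x + r; pose t := D y + r.
have hx : `|F x - H x s| <= 6 * a * r.
  by rewrite -[r](addrK (D x)) [r + _]addrC; apply: FP; rewrite ltrDl.
have hy : `|F y - H y t| <= 6 * a * r.
  by rewrite -[r](addrK (D y)) [r + _]addrC; apply: FP; rewrite ltrDl.
have hxy : `|H x s - H y s| <= K * mdist x y by apply: H2; rewrite /s; lra.
have hts : `|H y t - H y s| <= 6 * a * (s - t) by apply: H3; rewrite /s /t; lra.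
have dxy := Dlip x y.
have : a * (s - t) <= a * mdist x y by rewrite ler_wpM2l// /s /t; lra.
have := ler_distD (H x s) (F x) (F y).
have := ler_distD (H y s) (H x s) (F y).
have := ler_distD (H y t) (H y s) (F y).
rewrite [`|H y s - H y t|]distrC [`|H y t - F y|]distrC.
lra.
Qed.

(** * The l_p norm on sparse vectors *)

Lemma powRrK (R : realType) (x r : R) : 0 <= x -> r != 0 ->
  (x `^ r) `^ r^-1 = x.
Proof. by move=> x0 r0; rewrite -powRrM mulfV// powRr1. Qed.

Lemma lp_norm_ge0 (R : realType) (p : \bar R) n (v : 'rV[R]_n) :
  0 <= lp_norm p v.
Proof.
case: p => [r| |] //=; first exact: powR_ge0.
exact: bigmax_ge_id.
Qed.

Lemma ler_abs_lp_norm (R : realType) (p : \bar R) n (v : 'rV[R]_n) i :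
  (1 <= p)%E -> `|v 0 i| <= lp_norm p v.
Proof.
case: p => [r| |]//; last by move=> _; exact: le_bigmax.
rewrite lee_fin => r1 /=; have r0 : 0 < r by lra.
rewrite -[leLHS](powRrK (r := r))//; last by rewrite gt_eqF.
apply: ge0_ler_powR; rewrite ?nnegrE ?invr_ge0 ?powR_ge0 ?(ltW r0)//.
  by apply: sumr_ge0 => j _; exact: powR_ge0.
by rewrite (bigD1 i)//= lerDl sumr_ge0// => j _; exact: powR_ge0.
Qed.

Lemma sum_lp_norm (R : realType) (r : R) n (v : 'rV[R]_n) : 1 <= r ->
  \sum_i `|v 0 i| `^ r = lp_norm r%:E v `^ r.
Proof.
move=> r1; rewrite /= -powRrM mulVf ?powRr1 ?gt_eqF//; last lra.
by apply: sumr_ge0 => j _; exact: powR_ge0.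
Qed.

Lemma lp_norm_le_sup (R : realType) (p : \bar R) n (k : nat) (v : 'rV[R]_n)
    (b : R) : (1 <= p)%E -> (0 < k)%N -> 0 <= b ->
  (#|[pred i | v 0%R i != 0%R]| <= k)%N -> (forall i, `|v 0 i| <= b) ->
  lp_norm p v <= b * k%:R `^ fine p^-1.
Proof.
move=> p1 k0 b0 vk vb; case: p p1 => [r| |]//; last first.
  by move=> _; rewrite invey /= powRr0 mulr1; apply: bigmax_le.
rewrite lee_fin => r1; have r0 : 0 < r by lra.
rewrite fine_invr -[lp_norm _ _](powRrK (r := r)) ?lp_norm_ge0 ?gt_eqF//.
rewrite -[b in leRHS](powRrK (r := r)) ?gt_eqF// -powRM ?powR_ge0//.
apply: ge0_ler_powR; rewrite ?nnegrE ?invr_ge0 ?powR_ge0 ?(ltW r0)//.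
  by rewrite mulr_ge0 ?powR_ge0.
rewrite -sum_lp_norm// (bigID [pred i | v 0 i != 0])/= [X in _ + X]big1 ?addr0.
  apply: (@le_trans _ _ (\sum_(i | v 0 i != 0) b `^ r)).
    by apply: ler_sum => i _; rewrite ge0_ler_powR ?nnegrE// ltW.
  rewrite sumr_const -[leLHS]mulr_natr ler_wpM2l ?powR_ge0// ler_nat.
  by rewrite (leq_trans _ vk)// subset_leq_card.
by move=> i; rewrite negbK => /eqP ->; rewrite normr0 powR0// gt_eqF.
Qed.

(** Comparison of the l_2 and l_p norms on 2k-sparse vectors.  If p <= 2, the
    l_2 norm is at most the l_p norm N, since |v_i| <= N for all i.  If p > 2,
    compare each coordinate with the threshold h = N / k^(1/p): it satisfies
    v_i^2 <= h^2 + h^(2-p) |v_i|^p, and the sum over the support is at most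
    2k h^2 + h^(2-p) N^p = 3k h^2. *)
Lemma sparse_l2_le_lp (R : realType) (p : \bar R) n (k : nat) (v : 'rV[R]_n) :
  (1 <= p)%E -> (0 < k)%N -> (#|[pred i | v 0%R i != 0%R]| <= 2 * k)%N ->
  (k%:R `^ fine p^-1) ^+ 2 * \sum_i v 0 i ^+ 2
    <= 3 * (k%:R `^ Num.max (fine p^-1) 2^-1) ^+ 2 * lp_norm p v ^+ 2.
Proof.
move=> p1 k0 vk; set N := lp_norm p v.
have kR0 : 0 < k%:R :> R by rewrite ltr0n.
have kR1 : 1 <= k%:R :> R by rewrite ler1n.
have N0 : 0 <= N := lp_norm_ge0 p v.
have vN i : `|v 0 i| <= N by exact: ler_abs_lp_norm.
have half2 : (k%:R `^ 2^-1) ^+ 2 = k%:R :> R.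
  by rewrite powR12_sqrt ?sqr_sqrtr// ltW.
have supp (b : R) : 0 <= b -> \sum_(i | v 0 i != 0) b <= 2 * k%:R * b.
  move=> b0; rewrite sumr_const -[leLHS]mulr_natl ler_wpM2r//.
  by rewrite -natrM ler_nat (leq_trans _ vk)// subset_leq_card.
have sumE : \sum_i v 0 i ^+ 2 = \sum_(i | v 0 i != 0) `|v 0 i| ^+ 2.
  rewrite (bigID [pred i | v 0 i != 0])/= [X in _ + X]big1 ?addr0.
    by apply: eq_bigr => i _; rewrite real_normK ?num_real.
  by move=> i; rewrite negbK => /eqP ->; rewrite expr0n.
have [Ngt0|Nle0] := ltP 0 N; last first.
  rewrite sumE big1 ?mulr0 ?mulr_ge0 ?sqr_ge0// => i vi.
  by move: vi; rewrite -normr_le0 (le_trans (vN i) Nle0).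
case: p p1 @N N0 vN Ngt0 => [r| |]//; last first.
  move=> _ N N0 vN _; rewrite invey /= powRr0 expr1n mul1r max_r//.
  rewrite half2 sumE; apply: (@le_trans _ _ (\sum_(i | v 0 i != 0) N ^+ 2)).
    by apply: ler_sum => i _; rewrite lerXn2r ?nnegrE.
  apply: (le_trans (supp _ (sqr_ge0 _))).
  by have := sqr_ge0 N; nra.
rewrite lee_fin => r1 N N0 vN Ngt0; rewrite fine_invr.
have r0 : 0 < r by lra.
have rN : \sum_i `|v 0 i| `^ r = N `^ r by exact: sum_lp_norm.
have rN' : \sum_(i | v 0 i != 0) `|v 0 i| `^ r <= N `^ r.
  rewrite -rN [leRHS](bigID [pred i | v 0 i != 0])/= lerDl.
  by apply: sumr_ge0 => i _; exact: powR_ge0.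
have sqrE (t : R) : 0 < t -> t ^+ 2 = t `^ (2 - r) * t `^ r.
  by move=> t0; rewrite -powRD ?subrK ?powR_mulrn ?gt_eqF ?implybT// ltW.
have [r2|r2] := leP r 2.
  rewrite max_l; last by rewrite lef_pV2 ?posrE.
  suff : \sum_i v 0 i ^+ 2 <= N ^+ 2.
    have := sqr_ge0 (k%:R `^ r^-1 : R).
    have : 0 <= \sum_i v 0 i ^+ 2 by apply: sumr_ge0 => i _; exact: sqr_ge0.
    move: (_ ^+ 2) (\sum_i _) (N ^+ 2) => x y z y0 x0 yz.
    by have := ler_wpM2l x0 yz; have := mulr_ge0 x0 (le_trans y0 yz); lra.
  rewrite sumE [leRHS]sqrE//.
  apply: (le_trans _ (ler_wpM2l (powR_ge0 _ _) rN')).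
  rewrite mulr_sumr; apply: ler_sum => i vi.
  rewrite sqrE ?normr_gt0// ler_wpM2r ?powR_ge0// ge0_ler_powR ?nnegrE//; lra.
rewrite max_r; last by rewrite lef_pV2 ?posrE// ltW.
rewrite half2.
pose h := N / k%:R `^ r^-1.
have kr0 : 0 < k%:R `^ r^-1 :> R by rewrite powR_gt0.
have h0 : 0 < h by rewrite divr_gt0.
have hN : N = h * k%:R `^ r^-1 by rewrite divfK// gt_eqF.
have hr : N `^ r = h `^ r * k%:R.
  rewrite hN powRM ?(ltW h0) ?(ltW kr0)// -powRrM mulVf ?gt_eqF//.
  by rewrite powRr1// ltW.
suff : \sum_i v 0 i ^+ 2 <= 3 * k%:R * h ^+ 2.
  move=> H; rewrite hN exprMn; apply: (le_trans (ler_wpM2l (sqr_ge0 _) H)).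
  by rewrite mulrC !mulrA.
rewrite sumE.
apply: (@le_trans _ _
  (\sum_(i | v 0 i != 0) (h ^+ 2 + h `^ (2 - r) * `|v 0 i| `^ r))).
  apply: ler_sum => i vi; have vi0 : 0 < `|v 0 i| by rewrite normr_gt0.
  have [vh|/ltW hv] := leP `|v 0 i| h.
    rewrite (@le_trans _ _ (h ^+ 2))// ?lerXn2r ?nnegrE// ?(ltW h0)//.
    by rewrite lerDl mulr_ge0 ?powR_ge0.
  rewrite -[leLHS]add0r lerD ?sqr_ge0// [leLHS]sqrE// ler_wpM2r ?powR_ge0//.
  have E t : 0 < t -> t `^ (2 - r) = (t `^ (r - 2))^-1.
    by move=> t0; rewrite -powRN opprB.
  rewrite !E// lef_pV2 ?posrE ?powR_gt0// ge0_ler_powR ?nnegrE//; try lra.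
rewrite big_split/= -[X in _ + X]mulr_sumr.
have := ler_wpM2l (powR_ge0 h (2 - r)) rN'.
rewrite hr mulrA -sqrE//.
have := supp _ (sqr_ge0 h); lra.
Qed.

(** * Extension from sparse vectors *)

Lemma ler_norm_sum_combination (R : realType) (Z : normedModType R) (I : eqType)
    (r : seq I) (w : I -> R) (g : I -> Z) (b : R) :
  (forall i, w i != 0 -> `|g i| <= b) ->
  `|\sum_(i <- r) w i *: g i| <= (\sum_(i <- r) `|w i|) * b.
Proof.
move=> gb; rewrite (le_trans (ler_norm_sum _ _ _))// mulr_suml.
apply: ler_sum => i _; rewrite normrZ.
have [->|wi0] := eqVneq (w i) 0; first by rewrite normr0 !mul0r.
by rewrite ler_wpM2l// gb.
Qed.

Lemma powR_max_half_ge1 (R : realType) (k : nat) (t : R) : (0 < k)%N ->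
  1 <= k%:R `^ Num.max t 2^-1 :> R.
Proof.
move=> k0; rewrite -[leLHS](powRr0 k%:R) ler_powR ?ler1n//.
by rewrite le_max invr_ge0 ler0n orbT.
Qed.

(** G x is the mean of f (gam J), where a J is the random rounding of x on the
    grid of mesh a = s / k^(1/p) and gam J is a point of A within 3s of a J, if
    there is one.  If x is within 2s of A, there is one for every J that x may
    reach, because a J is within s of x.  So G x is a mean of values of f at
    points within 4s of x.  The variation of G between x and y at distance less
    than s is then at most O(s) times the total variation distance of the two
    roundings. *)
Lemma sparse_scale_extension (R : realType) (p : \bar R) (p1 : (1 <= p)%E)
    (n k : nat) (Z : normedModType R) (A : set (sparse_lp p1 n k))
    (f : sparse_lp p1 n k -> Z) (L s : R) :
  (0 < k)%N -> A !=set0 -> 0 <= L ->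
  (forall x y, A x -> A y -> `|f x - f y| <= L * mdist x y) -> 0 < s ->
  exists G : sparse_lp p1 n k -> Z,
    (forall x c, A c -> mdist x c <= 2 * s -> `|G x - f c| <= 6 * L * s) /\
    (forall x y b c, A b -> A c -> mdist x b <= 2 * s -> mdist y c <= 2 * s ->
      `|G x - G y| <=
        98 * L * k%:R `^ Num.max (fine p^-1) 2^-1 * mdist x y).
Proof.
move=> k0 [c0 Ac0] L0 fL s0.
have kR0 : 0 < k%:R :> R by rewrite ltr0n.
set E := k%:R `^ Num.max (fine p^-1) 2^-1.
have E1 : 1 <= E by exact: powR_max_half_ge1.
pose kappa : R := k%:R `^ fine p^-1.
have kappa0 : 0 < kappa by rewrite powR_gt0.
pose a := s / kappa.
have a0 : 0 < a by rewrite divr_gt0.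
have akappa : a * kappa = s by rewrite divfK// gt_eqF.
pose q (J : {ffun 'I_n -> int}) : 'rV[R]_n := \row_i (a * (J i)%:~R).
pose y_ (x : sparse_lp p1 n k) i := sparse_val x 0 i / a.
pose w x J := grid_weight (y_ x) J.
have /choice[gam gamP] : forall J, exists c, A c /\
    ((exists2 c', A c' & lp_norm p (q J - sparse_val c') <= 3 * s) ->
     lp_norm p (q J - sparse_val c) <= 3 * s).
  move=> J; have [[c Ac qc]|no] := pselect (exists2 c', A c' &
    lp_norm p (q J - sparse_val c') <= 3 * s); first by exists c.
  by exists c0.
have Agam J : A (gam J) := (gamP J).1.
have tri (u v t : 'rV[R]_n) :
    lp_norm p (u - t) <= lp_norm p (u - v) + lp_norm p (v - t).
  by rewrite -(subrKA v); exact: ler_lp_normD.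
have normC (u v : 'rV[R]_n) : lp_norm p (u - v) = lp_norm p (v - u).
  by rewrite -opprB lp_normN.
have supp_le (x : sparse_lp p1 n k) :
  (#|[pred i | sparse_val x 0%R i != 0%R]| <= k)%N by case: x.
have wq x J : w x J != 0 -> lp_norm p (q J - sparse_val x) <= s.
  move=> wxJ; rewrite -akappa; apply: lp_norm_le_sup; rewrite ?(ltW a0)//.
    apply: leq_trans (supp_le x); apply: subset_leq_card.
    apply/fintype.subsetP => i; rewrite !inE; apply: contra_neq => xi0.
    rewrite !mxE xi0 (grid_weight_support wxJ) ?mulr0 ?subr0//.
    by rewrite /y_ /= xi0 mul0r.
  move=> i; rewrite !mxE distrC.
  have -> : sparse_val x 0 i - a * (J i)%:~R = a * (y_ x i - (J i)%:~R).
    by rewrite mulrBr /y_ [a * (_ / a)]mulrC divfK// gt_eqF.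
  rewrite normrM ger0_norm ?(ltW a0)// -[leRHS]mulr1 ler_wpM2l ?(ltW a0)//.
  exact: grid_weight_near wxJ.
have wgam x c J : A c -> mdist x c <= 2 * s -> w x J != 0 ->
    mdist x (gam J) <= 4 * s.
  rewrite !mdist_sparse_lpE => Ac xc /wq qx.
  have qgam : lp_norm p (q J - sparse_val (gam J)) <= 3 * s.
    apply: (gamP J).2; exists c => //.
    by have := tri (q J) (sparse_val x) (sparse_val c); lra.
  have := tri (sparse_val x) (q J) (sparse_val (gam J)).
  rewrite (normC _ (q J)).
  by lra.
pose G x := \sum_(J \in [set: {ffun 'I_n -> int}]) w x J *: f (gam J).
have GE x rr : uniq rr -> (forall J, J \notin rr -> w x J = 0) ->
    G x = \sum_(J <- rr) w x J *: f (gam J).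
  move=> urr wrr; rewrite /G (@fsbigE _ _ _ _ _ rr)//.
    by under eq_bigl do rewrite in_setT.
  by move=> J _ /wrr ->; rewrite scale0r.
have G1 x c : A c -> mdist x c <= 2 * s -> `|G x - f c| <= 6 * L * s.
  move=> Ac xc.
  have [rr [urr [wrr [w1 _]]]] := grid_weight_cover (y_ x) (y_ x).
  have -> : G x - f c = \sum_(J <- rr) w x J *: (f (gam J) - f c).
    rewrite (GE x rr)//; last by move=> J /wrr[].
    under [RHS]eq_bigr do rewrite scalerBr.
    by rewrite sumrB -scaler_suml w1 scale1r.
  rewrite (le_trans (ler_norm_sum_combination (b := 6 * L * s) _ _))//.
    move=> J /(wgam _ _ _ Ac xc) xgam.
    apply: (le_trans (fL _ _ (Agam J) Ac)).
    rewrite -mulrA mulrCA ler_wpM2l//.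
    have := metric_triangle (gam J) x c; rewrite (metric_sym (gam J) x).
    lra.
  under eq_bigr do rewrite ger0_norm ?grid_weight_ge0//.
  by rewrite w1 mul1r.
exists G; split=> // x y b c Ab Ac xb yc.
have d0 := mdist_ge0 x y.
(* far points are compared through f b and f c *)
have [dge|/ltW dle] := leP s (mdist x y).
  have h1 := G1 x b Ab xb; have h2 := G1 y c Ac yc.
  have := ler_distD (f b) (G x) (G y); have := ler_distD (f c) (f b) (G y).
  rewrite (distrC (f c)).
  have := fL _ _ Ab Ac.
  have := metric_triangle b x c; have := metric_triangle x y c.
  rewrite (metric_sym b x) => t1 t2.
  have : L * mdist b c <= L * (5 * mdist x y) by rewrite ler_wpM2l//; lra.
  have : L * s <= L * mdist x y by rewrite ler_wpM2l.
  have : L * mdist x y <= L * mdist x y * E.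
    by rewrite -[leLHS]mulr1 ler_wpM2l// mulr_ge0.
  have : 0 <= L * mdist x y by rewrite mulr_ge0.
  lra.
have [xy0|xyn0] := eqVneq (mdist x y) 0.
  by rewrite xy0 mulr0 (mdist_positivity _ _ xy0) subrr normr0.
have {xyn0}d0 : 0 < mdist x y by rewrite lt_def xyn0.
have [rr [urr [wrr [wx1 [wy1 wxy]]]]] := grid_weight_cover (y_ x) (y_ y).
(* both weights have mass 1, so f b may be subtracted from the values of f *)
have -> : G x - G y = \sum_(J <- rr) (w x J - w y J) *: (f (gam J) - f b).
  rewrite (GE x rr)//; last by move=> J /wrr[].
  rewrite (GE y rr)//; last by move=> J /wrr[].
  under [RHS]eq_bigr do rewrite scalerBr.
  rewrite sumrB -scaler_suml sumrB wx1 wy1 subrr scale0r subr0 -sumrB.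
  by apply: eq_bigr => J _; rewrite scalerBl.
rewrite (le_trans (ler_norm_sum_combination (b := L * (7 * s)) _ _))//.
  move=> J wJ; apply: (le_trans (fL _ _ (Agam J) Ab)); rewrite ler_wpM2l//.
  have := metric_triangle (gam J) x b; rewrite (metric_sym (gam J) x).
  have [wx0|/(wgam _ _ _ Ab xb)] := eqVneq (w x J) 0; last by lra.
  have /(wgam _ _ _ Ac yc) : w y J != 0 by move: wJ; rewrite wx0 sub0r oppr_eq0.
  by have := metric_triangle x y (gam J); lra.
(* 7^2 >= 16 * 3, with 16 from grid_weight_cover and 3 from sparse_l2_le_lp *)
pose h := 7 * E * mdist x y / s.
have h0 : 0 < h by rewrite divr_gt0// !mulr_gt0// (lt_le_trans ltr01).
have /(ler_wpM2r _) : \sum_(J <- rr) `|w x J - w y J| <= 2 * h.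
  apply: wxy => //.
  have -> : \sum_i (y_ x i - y_ y i) ^+ 2 =
      (kappa ^+ 2 * \sum_i (sparse_val x - sparse_val y) 0 i ^+ 2) / s ^+ 2.
    rewrite mulrAC mulr_sumr; apply: eq_bigr => i _.
    rewrite /y_ -mulrBl !mxE exprMn -expr_div_n mulrC; congr (_ * _).
    by rewrite /a invf_div.
  rewrite mulrA ler_pdivrMr ?exprn_gt0// -exprMn divfK ?gt_eqF//.
  have /(sparse_l2_le_lp p1 k0) :
      (#|[pred i | (sparse_val x - sparse_val y)%R 0%R i != 0%R]| <= 2 * k)%N.
    rewrite mul2n -addnn; apply: leq_trans (leq_add (supp_le x) (supp_le y)).
    rewrite -cardUI (leq_trans _ (leq_addr _ _))// subset_leq_card//.
    apply/fintype.subsetP => i; rewrite !inE !mxE; apply: contra_neqT.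
    by rewrite negb_or !negbK => /andP[/eqP -> /eqP ->]; rewrite subrr.
  rewrite -mdist_sparse_lpE -/kappa -/E !exprMn.
  have : 0 <= E ^+ 2 * mdist x y ^+ 2 by rewrite mulr_ge0 ?sqr_ge0.
  lra.
move=> /(_ (L * (7 * s))) H; apply: (le_trans (H _)).
  by rewrite !mulr_ge0// ltW.
rewrite le_eqVlt; apply/orP; left; apply/eqP.
by rewrite /h; field; rewrite gt_eqF.
Qed.

Lemma lip_const_attained (R : realType) (M : metricType R)
    (Z : normedModType R) (A : set M) (f : M -> Z) :
  (lip_const A f < +oo)%E -> exists L : R,
    [/\ lip_const A f = L%:E, 0 <= L &
        forall x y, A x -> A y -> `|f x - f y| <= L * mdist x y].
Proof.
move=> foo.
have c0 : (0 <= lip_const A f)%E.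
  by apply: le_ereal_inf_tmp => _ [K [K0 _] <-]; rewrite lee_fin.
have cfin : lip_const A f \is a fin_num by rewrite ge0_fin_numE.
exists (fine (lip_const A f)); rewrite fineK//; split=> //.
  by rewrite fine_ge0.
move=> x y Ax Ay; have [xy0|xy0] := eqVneq (mdist x y) 0.
  by rewrite xy0 mulr0 (mdist_positivity _ _ xy0) subrr normr0.
have xy : 0 < mdist x y by rewrite lt_def xy0 mdist_ge0.
rewrite -ler_pdivrMr// -lee_fin fineK//.
apply: le_ereal_inf_tmp => _ [K [K0 fK] <-].
by rewrite lee_fin ler_pdivrMr// fK.
Qed.

Theorem theorem20 (R : realType) :
  exists C : R, 0 < C /\
    forall (p : \bar R) (p1 : (1 <= p)%E) (n k : nat),
      (1 <= k <= n)%N ->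
      (lip_ext_modulus (sparse_lp p1 n k)
        <= (C * k%:R `^ Num.max (fine p^-1) 2^-1)%:E)%E.
Proof.
(* 134 = 98 + 6 * 6 *)
exists 134; split=> // p p1 n k /andP[k0 _].
set E := k%:R `^ Num.max (fine p^-1) 2^-1.
have E1 : 1 <= E by exact: powR_max_half_ge1.
apply: ge_ereal_inf; exists (134 * E)%:E => //; split.
  by rewrite lee_fin; lra.
move=> A Z f A0 /lip_const_attained[L [-> L0 fL]].
have a0 : 0 <= 6 * L by rewrite mulr_ge0.
have [F [FA FL]] := lipschitz_extension_of_scales (K := 98 * L * E) A0 a0
  (fun s s0 => sparse_scale_extension k0 A0 L0 fL s0).
exists F; split=> //; apply: ge_ereal_inf.
exists (134 * E * L)%:E => //; exists (134 * E * L) => //.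
split=> [|x y _ _]; first by rewrite !mulr_ge0// (le_trans ler01).
apply: (le_trans (FL x y)); rewrite ler_wpM2r ?mdist_ge0//.
by have := ler_wpM2l L0 E1; lra.
Qed.
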